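(* Let $K$ be a locally compact Hausdorff topological space which is not $\sigma$-compact and in which every countable family of compact sets is contained in some compact set. Consider $C_0(K)$ as a Hilbert $C^*$-module over itself. Then the identity operator $\mathrm{Id}:C_0(K)\to C_0(K)$ is not $C_0(K)$-compact.
   Context: $C_0(K)$ is the $C^*$-algebra of continuous complex-valued functions on $K$ vanishing at infinity, with the sup norm; as a Hilbert module over itself its inner product is $\langle a,b\rangle=a^*b$. ''Every countable family of compact sets is contained in some compact set'' means that for any compact $K_1,K_2,\dots\subset K$ there is a compact $K'\subset K$ with $\bigcup_n K_n\subset K'$. $\mathcal A$-compact operators: for Hilbert $C^*$-modules $\mathcal M,\mathcal N$ over a $C^*$-algebra $\mathcal A$, and $x\in\mathcal N$, $y\in\mathcal M$, the elementary $\mathcal A$-compact operator $\theta_{x,y}:\mathcal M\to\mathcal N$ is $\theta_{x,y}(z)=x\langle y,z\rangle$. An operator $\mathcal M\to\mathcal N$ (bounded $\mathcal A$-homomorphism) is $\mathcal A$-compact if it belongs to the operator-norm closure of the linear span of the elementary $\mathcal A$-compact operators. *)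

(* Defs.v *)
From HB Require Import structures.
From mathcomp Require Import all_boot all_order all_algebra.
From mathcomp Require Import complex.
From mathcomp Require Import all_classical all_reals all_analysis.

Set Implicit Arguments.
Unset Strict Implicit.
Unset Printing Implicit Defensive.

Import Order.TTheory GRing.Theory Num.Theory.
Import numFieldNormedType.Exports.
Import ComplexField.Normc.

Local Open Scope classical_set_scope.
Local Open Scope ring_scope.
Local Open Scope complex_scope.

(* The algebra need not be unital. As for every normed module over [R[i]], the
   norm takes its values in [R[i]], where [0 <= z] implies that [z] is real. *)
HB.mixin Record isCStarAlgebra (R : realType) (A : Type)
    & CompleteNormedModule R[i] A := {
  csmul : A -> A -> A ;
  csadj : A -> A ;
  csmulA : forall a b c, csmul a (csmul b c) = csmul (csmul a b) c ;
  csmulDl : forall a b c, csmul (a + b) c = csmul a c + csmul b c ;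
  csmulDr : forall a b c, csmul a (b + c) = csmul a b + csmul a c ;
  csmulZl : forall (k : R[i]) a b, csmul (k *: a) b = k *: csmul a b ;
  csmulZr : forall (k : R[i]) a b, csmul a (k *: b) = k *: csmul a b ;
  csadjK : forall a, csadj (csadj a) = a ;
  csadjD : forall a b, csadj (a + b) = csadj a + csadj b ;
  csadjZ : forall (k : R[i]) a, csadj (k *: a) = k^* *: csadj a ;
  csadjM : forall a b, csadj (csmul a b) = csmul (csadj b) (csadj a) ;
  csnormM : forall a b, `|csmul a b| <= `|a| * `|b| ;
  csnorm_adj : forall a, `|csmul (csadj a) a| = `|a| ^+ 2 }.

#[short(type="cStarAlgType")]
HB.structure Definition CStarAlgebra (R : realType) :=
  {A of isCStarAlgebra R A & CompleteNormedModule R[i] A}.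

(* Right Hilbert modules, the inner product being linear in its second
   argument. Positivity of an element of a C*-algebra is being of the form
   [b^* b]; definiteness of the inner product follows from [hnormE]. *)
HB.mixin Record isHilbertModule (R : realType) (A : cStarAlgType R) (E : Type)
    & CompleteNormedModule R[i] E := {
  hact : E -> A -> E ;
  hinner : E -> E -> A ;
  hactDl : forall x y a, hact (x + y) a = hact x a + hact y a ;
  hactDr : forall x a b, hact x (a + b) = hact x a + hact x b ;
  hactZl : forall (k : R[i]) x a, hact (k *: x) a = k *: hact x a ;
  hactZr : forall (k : R[i]) x a, hact x (k *: a) = k *: hact x a ;
  hactM : forall x a b, hact x (csmul a b) = hact (hact x a) b ;
  hinnerD : forall x y z, hinner x (y + z) = hinner x y + hinner x z ;
  hinnerZ : forall (k : R[i]) x y, hinner x (k *: y) = k *: hinner x y ;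
  hinner_act : forall x y a, hinner x (hact y a) = csmul (hinner x y) a ;
  hinner_sym : forall x y, csadj (hinner x y) = hinner y x ;
  hinner_pos : forall x, exists b, hinner x x = csmul (csadj b) b ;
  hnormE : forall x, `|x| ^+ 2 = `|hinner x x| }.

#[short(type="hilbertModType")]
HB.structure Definition HilbertModule (R : realType) (A : cStarAlgType R) :=
  {E of isHilbertModule R A E & CompleteNormedModule R[i] E}.

(* Bounded A-homomorphisms; no adjoint is required. *)
Record hilbert_op (R : realType) (A : cStarAlgType R)
    (M N : hilbertModType A) := HilbertOp {
  hop_fun :> {linear M -> N} ;
  hop_act : forall (x : M) (a : A), hop_fun (hact x a) = hact (hop_fun x) a ;
  hop_bounded : exists C : R, forall x : M, `|hop_fun x| <= C%:C * `|x| }.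

Section compact_operators.
Context {R : realType} {A : cStarAlgType R}.

Program Definition hop_id (M : hilbertModType A) : hilbert_op M M :=
  @HilbertOp R A M M idfun _ _.
Next Obligation. by []. Qed.
Next Obligation. by move=> M; exists 1 => x; rewrite mul1r. Qed.

Context {M N : hilbertModType A}.

Definition theta (x : N) (y : M) : M -> N := fun z => hact x (hinner y z).

Definition theta_span : set (M -> N) :=
  [set S | exists (n : nat) (c : 'I_n -> R[i]) (x : 'I_n -> N) (y : 'I_n -> M),
    S = fun z => \sum_(i < n) c i *: theta (x i) (y i) z].

(* extended-real valued, hence [+oo] on maps that are not bounded *)
Definition opnorm (f : M -> N) : \bar R :=
  ereal_sup [set (complex.Re `|f z|)%:E | z in [set z : M | `|z| <= 1]].

Definition A_compact (T : hilbert_op M N) : Prop :=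
  forall e : R, 0 < e ->
    exists2 S, theta_span S & (opnorm (fun z => T z - S z)%R < e%:E)%E.

End compact_operators.

(* A C*-algebra as a Hilbert module over itself. *)
Definition self_module (R : realType) (A : cStarAlgType R) : Type := A.

Section self_module.
Context {R : realType} {A : cStarAlgType R}.

HB.instance Definition _ := CompleteNormedModule.on (self_module A).

Let innerA (x y : self_module A) : A := csmul (csadj x) y.

Let act (x : self_module A) (a : A) : self_module A := csmul x a.

Let innerD x y z : innerA x (y + z) = innerA x y + innerA x z.
Proof. exact: csmulDr. Qed.

Let innerZ (k : R[i]) x y : innerA x (k *: y) = k *: innerA x y.
Proof. exact: csmulZr. Qed.

Let inner_act x y a : innerA x (act y a) = csmul (innerA x y) a.
Proof. exact: csmulA. Qed.

Let inner_sym x y : csadj (innerA x y) = innerA y x.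
Proof. by rewrite /innerA csadjM csadjK. Qed.

Let inner_pos x : exists b, innerA x x = csmul (csadj b) b.
Proof. by exists x. Qed.

Let normE (x : self_module A) : `|x| ^+ 2 = `|innerA x x|.
Proof. exact/esym/csnorm_adj. Qed.

HB.instance Definition _ := isHilbertModule.Build R A (self_module A)
  csmulDl csmulDr csmulZl csmulZr csmulA
  innerD innerZ inner_act inner_sym inner_pos normE.

End self_module.

(* The topology of [R[i]] is the one of its regular module [R[i]^o]. *)
Definition vanishes_at_infinity (R : realType) (K : topologicalType)
    (f : K -> R[i]^o) : Prop :=
  forall e : R, 0 < e ->
    exists2 L : set K, compact L & forall x, ~ L x -> normc (f x) < e.

Section C0.
Context (R : realType) (K : topologicalType).

Definition C0_pred : {pred K -> R[i]^o} :=
  [pred f | `[< continuous f /\ vanishes_at_infinity f >]].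

Record C0 := MkC0 { C0_fun :> K -> R[i]^o ; _ : C0_fun \in C0_pred }.

HB.instance Definition _ := [isSub for C0_fun].
HB.instance Definition _ := [Choice of C0 by <:].

Lemma C0P (f : C0) : continuous f /\ vanishes_at_infinity f.
Proof. by case: f => f /= /asboolP. Qed.

Lemma normc_normr (z : R[i]) : `|z| = (normc z)%:C.
Proof. by []. Qed.

Lemma cvgCP (T : Type) (F : set_system T) {FF : Filter F} (f : T -> R[i]^o)
    (l : R[i]^o) :
  (forall e : R, 0 < e -> \forall t \near F, normc (l - f t) < e) ->
  f @ F --> l.
Proof.
move=> H; apply/cvgrPdist_lt => -[e i] /=.
rewrite ltcE /= => /andP[/eqP i0 e0]; rewrite i0.
near=> t; rewrite [`|_|]normc_normr ltcR; near: t; exact: H.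
Unshelve. all: by end_near. Qed.

Lemma cvgC_norm (T : Type) (F : set_system T) {FF : Filter F} (f : T -> R[i]^o)
    (l : R[i]^o) : f @ F --> l ->
  forall e : R, 0 < e -> \forall t \near F, normc (l - f t) < e.
Proof.
move=> /cvgrPdist_lt H e e0; have e0' : 0 < e%:C by rewrite ltcR.
near=> t; rewrite -ltcR; near: t; exact: H.
Unshelve. all: by end_near. Qed.

Lemma normc_ge0 (z : R[i]) : 0 <= normc z.
Proof. by rewrite -lecR; exact: (normr_ge0 z). Qed.

Lemma normcD_le (y z : R[i]) : normc (y + z) <= normc y + normc z.
Proof. by rewrite -lecR rmorphD; exact: (ler_normD y z). Qed.

Lemma normcB (y z : R[i]) : normc (y - z) = normc (z - y).
Proof. by apply: complexI; exact: (distrC y z). Qed.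

Lemma normc_conj (z : R[i]) : normc z^* = normc z.
Proof. by case: z => a b; rewrite /= sqrrN. Qed.

Lemma normc_dist (y z : R[i]) : `|normc y - normc z| <= normc (y - z).
Proof.
have H (u v : R[i]) : normc u - normc v <= normc (u - v).
  by rewrite lerBlDr; apply: le_trans (normcD_le _ _); rewrite subrK.
by rewrite ler_norml lerNl opprB normcB H normcB H.
Qed.

Lemma normc_Re (z : R[i]) : `|complex.Re z| <= normc z.
Proof.
case: z => a b; rewrite /= -sqrtr_sqr ler_sqrt ?addr_ge0 ?sqr_ge0 //.
by rewrite lerDl sqr_ge0.
Qed.

Lemma normc_Im (z : R[i]) : `|complex.Im z| <= normc z.
Proof.
case: z => a b; rewrite /= -sqrtr_sqr ler_sqrt ?addr_ge0 ?sqr_ge0 //.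
by rewrite lerDr sqr_ge0.
Qed.

Lemma normc_ReIm (z : R[i]) :
  normc z <= `|complex.Re z| + `|complex.Im z|.
Proof.
case: z => a b /=; rewrite -ler_sqr ?nnegrE ?addr_ge0 ?sqrtr_ge0 //.
rewrite sqr_sqrtr ?addr_ge0 ?sqr_ge0 // sqrrD !real_normK ?num_real //.
by rewrite addrAC lerDl mulrn_wge0 // mulr_ge0.
Qed.

Lemma continuous_normc (f : K -> R[i]^o) :
  continuous f -> continuous (fun x => normc (f x)).
Proof.
move=> fc x; apply/cvgrPdist_lt => e e0.
near=> t; apply: le_lt_trans (normc_dist _ _) _; near: t.
exact: (cvgC_norm (fc x)).
Unshelve. all: by end_near. Qed.

Lemma C0_bounded (f : C0) : exists2 B : R, 0 <= B & forall x, normc (f x) <= B.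
Proof.
have [fc /(_ 1 ltr01)[L cL fL]] := C0P f.
have cgL : compact [set normc (f x) | x in L].
  apply: continuous_compact => //; apply: continuous_subspaceT.
  exact: continuous_normc.
have [M [_ HM]] := compact_bounded cgL.
pose B := Num.max 1 (M + 1).
exists B; first by rewrite le_max ler01.
move=> x; have [Lx|nLx] := pselect (L x); last first.
  by rewrite le_max ltW // fL.
rewrite le_max; apply/orP; right.
have := HM (M + 1) (ltr_pwDr ltr01 (lexx _)) (normc (f x)).
rewrite [X in X -> _ ]/= => /(_ (ex_intro2 _ _ x Lx erefl)).
exact: le_trans (ler_norm _).
Qed.

Lemma C0_submod_closed : submod_closed C0_pred.
Proof.
split=> [|a f g /asboolP[fc fv] /asboolP[gc gv]]; apply/asboolP; split.
- by move=> x; exact: cvg_cst.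
- move=> e e0; exists set0; first exact: compact0.
  by move=> x _; rewrite normc0.
- by move=> x; apply: cvgD; [apply: cvgZl_tmp; exact: fc|exact: gc].
- move=> e e0; have e20 : 0 < e / 2 by rewrite divr_gt0.
  have a1 : 0 < normc a + 1 by rewrite ltr_pwDr // normc_ge0.
  have [L1 cL1 L1f] := fv (e / 2 / (normc a + 1)) (divr_gt0 e20 a1).
  have [L2 cL2 L2g] := gv _ e20.
  exists (L1 `|` L2); first exact: compactU.
  move=> x /not_orP[/L1f fx /L2g gx].
  apply: le_lt_trans (normcD_le _ _) _; rewrite [e]splitr ltrD //.
  rewrite normcM; move: fx; rewrite ltr_pdivlMr // mulrC; apply: le_lt_trans.
  by rewrite ler_wpM2r ?normc_ge0 // lerDl.
Qed.

HB.instance Definition _ := GRing.isSubmodClosed.Build R[i] (K -> R[i]^o)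
  C0_pred C0_submod_closed.
HB.instance Definition _ := [SubChoice_isSubLmodule of C0 by <:].

Lemma C0_ext (f g : C0) : (forall x, f x = g x) -> f = g.
Proof. by move=> fg; apply/val_inj/funext. Qed.

Definition C0_sup (f : C0) : R := sup [set normc (f x) | x in setT].

Lemma C0_sup_ub (f : C0) x : normc (f x) <= C0_sup f.
Proof.
have [B _ fB] := C0_bounded f.
apply: ub_le_sup; last by exists x.
by exists B => _ [y _ <-].
Qed.

Lemma C0_sup_le (f : C0) (B : R) :
  0 <= B -> (forall x, normc (f x) <= B) -> C0_sup f <= B.
Proof.
move=> B0 fB; rewrite /C0_sup.
have [->|/set0P S0] := eqVneq [set normc (f x) | x in setT] set0.
  by rewrite sup0.
by apply: ge_sup => // _ [x _ <-].
Qed.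

Let norm (f : C0) : R[i] := (C0_sup f)%:C.

Lemma C0_sup_ge0 (f : C0) : 0 <= C0_sup f.
Proof.
have [[x _]|K0] := pselect (exists x : K, True).
  exact: le_trans (normc_ge0 (f x)) (C0_sup_ub f x).
rewrite /C0_sup (_ : [set _ | _ in _] = set0) ?sup0 //.
by apply/seteqP; split=> // y [x]; case: K0; exists x.
Qed.

Let norm_triangle f g : norm (f + g) <= norm f + norm g.
Proof.
rewrite /norm -rmorphD lecR; apply: C0_sup_le => [|x].
  by rewrite addr_ge0 ?C0_sup_ge0.
exact: le_trans (normcD_le _ _) (lerD (C0_sup_ub f x) (C0_sup_ub g x)).
Qed.

Let C0_supZ_le (k : R[i]) (f : C0) : C0_sup (k *: f) <= normc k * C0_sup f.
Proof.
apply: C0_sup_le => [|x]; first by rewrite mulr_ge0 ?normc_ge0 ?C0_sup_ge0.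
rewrite [(k *: f) x]/(k * f x) normcM.
by rewrite ler_wpM2l ?normc_ge0 ?C0_sup_ub.
Qed.

Let norm_scale (k : R[i]) f : norm (k *: f) = `|k| * norm f.
Proof.
rewrite [`|k|]normc_normr /norm -rmorphM; congr (_%:C).
apply/eqP; rewrite eq_le C0_supZ_le /=.
have [->|k0] := eqVneq k 0; first by rewrite normc0 mul0r C0_sup_ge0.
have nk0 : 0 < normc k.
  by rewrite lt_def normc_ge0 andbT; apply: contra k0 => /eqP/eq0_normc ->.
rewrite mulrC -ler_pdivlMr // mulrC -normcV.
by rewrite -[X in C0_sup X <= _](scalerK k0) C0_supZ_le.
Qed.

Let norm_eq0 f : norm f = 0 -> f = 0.
Proof.
move=> /complexI f0; apply: C0_ext => x; apply: eq0_normc.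
by apply/eqP; rewrite eq_le normc_ge0 andbT -f0 C0_sup_ub.
Qed.

HB.instance Definition _ := Lmodule_isNormed.Build R[i] C0
  norm_triangle norm_scale norm_eq0.

Lemma C0_normE (f : C0) : `|f| = (C0_sup f)%:C.
Proof. by []. Qed.

Let C0_cvg (F : set_system C0) {FF : ProperFilter F} : cauchy F -> cvg F.
Proof.
move=> /cauchy_ballP Fc.
have FcE (e : R) : 0 < e -> \forall f & g \near F, C0_sup (g - f) < e.
  move=> e0; have e0' : 0 < e%:C by rewrite ltcR.
  apply: filterS (Fc _ e0') => -[f g] /=.
  by rewrite -ball_normE /ball_ /= distrC C0_normE ltcR.
have Fcx (x : K) (p : R[i] -> R) : (forall y z, `|p y - p z| <= normc (y - z)) ->
    cvg ((fun f : C0 => p (f x)) @ F).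
  move=> pL; apply: R_complete; apply/cauchy_ballP => e e0.
  rewrite near_map2.
  apply: filterS (FcE _ e0) => -[f g] /= fg.
  rewrite /ball /= distrC; apply: le_lt_trans (pL _ _) _.
  exact: le_lt_trans (C0_sup_ub (g - f) x) fg.
have Re_lip (y z : R[i]) : `|complex.Re y - complex.Re z| <= normc (y - z).
  by rewrite -raddfB; exact: normc_Re.
have Im_lip (y z : R[i]) : `|complex.Im y - complex.Im z| <= normc (y - z).
  by rewrite -raddfB; exact: normc_Im.
pose l (x : K) : R[i]^o := Complex (lim ((fun f : C0 => complex.Re (f x)) @ F))
                               (lim ((fun f : C0 => complex.Im (f x)) @ F)).
have Fl (x : K) : (fun f : C0 => f x) @ F --> l x.
  apply: cvgCP => e e0; have e20 : 0 < e / 2 by rewrite divr_gt0.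
  have /cvgrPdist_lt/(_ _ e20) H1 := Fcx x _ Re_lip.
  have /cvgrPdist_lt/(_ _ e20) H2 := Fcx x _ Im_lip.
  near=> f; apply: le_lt_trans (normc_ReIm _) _; rewrite [e]splitr !raddfB.
  by rewrite ltrD //; near: f; [exact: H1|exact: H2].
have Fu (e : R) : 0 < e -> F [set f : C0 | forall x, normc (l x - f x) < e].
  move=> e0; have e20 : 0 < e / 2 by rewrite divr_gt0.
  near=> f => x; near F => g.
  rewrite -(subrK (g x) (l x)) -addrA.
  apply: le_lt_trans (normcD_le _ _) _; rewrite [e]splitr ltrD //.
    by near: g; exact: (cvgC_norm (Fl x)).
  apply: le_lt_trans (C0_sup_ub (g - f) x) _.
  near: g; near: f; apply: nearP_dep; exact: FcE.
have lC0 : l \in C0_pred.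
  apply/asboolP; split=> [x|e e0].
    apply: cvgCP => e e0; have e30 : 0 < e / 2 / 2 by rewrite !divr_gt0.
    near F => f; have [fc _] := C0P f.
    have fl : forall y, normc (l y - f y) < e / 2 / 2 by near: f; exact: Fu.
    near=> t.
    rewrite (_ : l x - l t = (l x - f x) + (f x - f t) + (f t - l t)); last first.
      by rewrite !addrA !subrK.
    rewrite [e]splitr; apply: le_lt_trans (normcD_le _ _) _; rewrite ltrD //.
      rewrite [e/2]splitr; apply: le_lt_trans (normcD_le _ _) _; rewrite ltrD //.
      by near: t; exact: (cvgC_norm (fc x)).
    rewrite normcB (lt_le_trans (fl t)) // [leRHS]splitr lerDl ltW //.
  have e20 : 0 < e / 2 by rewrite divr_gt0.
  near F => f; have [_ /(_ _ e20)[L cL fL]] := C0P f.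
  have fl : forall y, normc (l y - f y) < e / 2 by near: f; exact: Fu.
  exists L => // x /fL fx; rewrite -(subrK (f x) (l x)).
  apply: le_lt_trans (normcD_le _ _) _; by rewrite [e]splitr ltrD.
apply/cvg_ex; exists (MkC0 lC0).
apply/cvgrPdist_le => -[e i] /=; rewrite ltcE /= => /andP[/eqP i0 e0].
rewrite i0; near=> f; rewrite C0_normE lecR; apply: C0_sup_le; first exact: ltW.
have fl : forall y, normc (l y - f y) < e by near: f; exact: Fu.
by move=> x; exact/ltW/fl.
Unshelve. all: by end_near. Qed.

HB.instance Definition _ := Uniform_isComplete.Build C0 (@C0_cvg).

Let C0_mul_subproof (f g : C0) : (fun x => f x * g x : R[i]^o) \in C0_pred.
Proof.
have [[fc fv] [gc _]] := (C0P f, C0P g).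
apply/asboolP; split=> [x|e e0]; first by apply: cvgM; [exact: fc|exact: gc].
have [B B0 gB] := C0_bounded g.
have B1 : 0 < B + 1 by rewrite ltr_pwDr.
have [L cL fL] := fv _ (divr_gt0 e0 B1); exists L => // x /fL.
rewrite normcM ltr_pdivlMr //; apply: le_lt_trans.
by rewrite ler_wpM2l ?normc_ge0 // (le_trans (gB x)) // lerDl.
Qed.

Let C0_conj_subproof (f : C0) : (fun x => (f x)^* : R[i]^o) \in C0_pred.
Proof.
have [fc fv] := C0P f.
apply/asboolP; split=> [x|e /fv[L cL fL]]; last first.
  by exists L => // x /fL; rewrite normc_conj.
apply: cvgCP => e e0; near=> t; rewrite -rmorphB normc_conj; near: t.
exact: (cvgC_norm (fc x)).
Unshelve. all: by end_near. Qed.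

Definition C0_mul (f g : C0) : C0 := MkC0 (C0_mul_subproof f g).

Definition C0_conj (f : C0) : C0 := MkC0 (C0_conj_subproof f).

Let C0_mulA f g h : C0_mul f (C0_mul g h) = C0_mul (C0_mul f g) h.
Proof. by apply: C0_ext => x; exact: mulrA. Qed.

Let C0_mulDl f g h : C0_mul (f + g) h = C0_mul f h + C0_mul g h.
Proof. by apply: C0_ext => x; exact: mulrDl. Qed.

Let C0_mulDr f g h : C0_mul f (g + h) = C0_mul f g + C0_mul f h.
Proof. by apply: C0_ext => x; exact: mulrDr. Qed.

Let C0_mulZl (k : R[i]) f g : C0_mul (k *: f) g = k *: C0_mul f g.
Proof. by apply: C0_ext => x; exact/esym/mulrA. Qed.

Let C0_mulZr (k : R[i]) f g : C0_mul f (k *: g) = k *: C0_mul f g.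
Proof. by apply: C0_ext => x; exact: mulrCA. Qed.

Let C0_conjK f : C0_conj (C0_conj f) = f.
Proof. by apply: C0_ext => x; exact: conjcK. Qed.

Let C0_conjD f g : C0_conj (f + g) = C0_conj f + C0_conj g.
Proof. by apply: C0_ext => x; exact: (rmorphD conjc). Qed.

Let C0_conjZ (k : R[i]) f : C0_conj (k *: f) = k^* *: C0_conj f.
Proof. by apply: C0_ext => x; exact: (rmorphM conjc). Qed.

Let C0_conjM f g : C0_conj (C0_mul f g) = C0_mul (C0_conj g) (C0_conj f).
Proof. by apply: C0_ext => x; rewrite /= mulrC; exact: (rmorphM conjc). Qed.

Let C0_normM f g : `|C0_mul f g| <= `|f| * `|g|.
Proof.
rewrite !C0_normE -rmorphM lecR; apply: C0_sup_le => [|x].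
  by rewrite mulr_ge0 ?C0_sup_ge0.
by rewrite normcM ler_pM ?normc_ge0 ?C0_sup_ub.
Qed.

Let C0_norm_conj f : `|C0_mul (C0_conj f) f| = `|f| ^+ 2.
Proof.
rewrite !C0_normE -rmorphXn; congr (_%:C); apply/eqP; rewrite eq_le.
apply/andP; split.
  apply: C0_sup_le => [|x]; first by rewrite exprn_ge0 ?C0_sup_ge0.
  by rewrite normcM normc_conj -expr2 lerXn2r ?nnegrE ?normc_ge0 ?C0_sup_ge0
     ?C0_sup_ub.
rewrite -ler_sqrt ?C0_sup_ge0 // sqrtr_sqr ger0_norm ?C0_sup_ge0 //.
apply: C0_sup_le => [|x]; first exact: sqrtr_ge0.
rewrite -[leLHS](ger0_norm (normc_ge0 _)) -sqrtr_sqr ler_sqrt ?C0_sup_ge0 //.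
apply: le_trans (C0_sup_ub (C0_mul (C0_conj f) f) x).
by rewrite normcM normc_conj expr2.
Qed.

HB.instance Definition _ := isCStarAlgebra.Build R C0
  C0_mulA C0_mulDl C0_mulDr C0_mulZl C0_mulZr C0_conjK C0_conjD C0_conjZ
  C0_conjM C0_normM C0_norm_conj.

End C0.

Definition sigma_compact (K : topologicalType) : Prop :=
  exists F : nat -> set K, (forall n, compact (F n)) /\ \bigcup_n F n = [set: K].

(* Main.v *)
Require Import Defs.
From mathcomp Require Import all_boot all_order all_algebra.
From mathcomp Require Import complex.
From mathcomp Require Import all_classical all_reals all_analysis.

Import Order.TTheory GRing.Theory Num.Theory.
Import numFieldNormedType.Exports.
Import ComplexField.Normc.

Local Open Scope classical_set_scope.

(** Every [f] in [C_0(K)] has its nonzero set inside a countable union of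
    compact sets, hence, by the countability hypothesis, inside a single compact
    set ([C0_compact_cozero]). A finite combination [S] of operators [theta (x
    i) (y i)] takes its values in the ideal generated by the [x i], so all the
    functions [S z] vanish outside one compact set [L] ([theta_span_vanish]). As
    [K] is not sigma-compact, hence not compact, there is a point [p] outside
    [L], and by local compactness and Hausdorffness a function [f] of norm at
    most [1] in [C_0(K)] with [f p = 1] ([C0_bump]). Then [f - S f] has value
    [1] at [p], so the distance from the identity to any such [S] is at least
    [1]. *)

(** The sets where [f] has modulus at least [1 / (n + 1)] lie in compact sets
    [F n]; a compact set containing all of them captures every nonzero value. *)
Lemma C0_compact_cozero (R : realType) (K : topologicalType)
  (K_countable : forall F : nat -> set K, (forall n, compact (F n)) ->
     exists2 K' : set K, compact K' & \bigcup_n F n `<=` K')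
  (f : C0 R K) :
  exists2 L : set K, compact L & forall x, ~ L x -> f x = 0%R.
Proof.
have [_ fv] := C0P f.
have {}fv n : exists L : set K,
    compact L /\ forall x, ~ L x -> (normc (f x) < n.+1%:R^-1)%R.
  by have [|L cL fL] := fv (n.+1%:R^-1)%R; [rewrite invr_gt0|exists L].
have [F HF] := choice fv.
have [L cL FL] := K_countable F (fun n => (HF n).1).
exists L => // x nLx; apply: eq0_normc.
apply/eqP; rewrite eq_le normc_ge0 andbT; apply/ler_addgt0Pl => e e0.
rewrite addr0; have [n ne] := ltr_add_invr (y := 0%R) (x := e) e0.
rewrite add0r in ne; apply: ltW; apply: lt_trans ne.
by apply: (HF n).2 => Fx; apply/nLx/FL; exists n.
Qed.

(** Complete regularity of locally compact Hausdorff spaces separates [p] from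
    the complement of a compact neighborhood; the separating function then
    vanishes at infinity because it is zero outside that neighborhood. *)
Lemma C0_bump (R : realType) (K : topologicalType)
  (K_lc : locally_compact [set: K]) (K_hausdorff : hausdorff_space K) (p : K) :
  exists2 f : C0 R K, f p = 1%R & (C0_sup f <= 1)%R.
Proof.
have [U] := K_lc p I; rewrite withinET => Up [cU clU].
have : uniform_separator [set p] (~` U°).
  apply: (@locally_compact_completely_regular K R) => //.
  exact/open_closedC/open_interior.
move=> /(@uniform_separatorP _ R)[u [uc u01 up u1]].
(* [u] is [0] at [p] and [1] off the interior of [U], hence the complement to 1. *)
pose g x : R[i]%C^o := ((1 - u x)%:C)%C%R.
have normg x : normc (g x) = (1 - u x)%R.
  rewrite /= expr0n addr0 sqrtr_sqr ger0_norm // subr_ge0.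
  by have /andP[] : (u x \in `[0, 1])%R by apply: u01; exists x.
have gC0 : g \in @C0_pred R K.
  apply/asboolP; split=> [x|e e0].
    apply: cvgCP => e e0; have /cvgrPdist_lt/(_ _ e0) := uc x.
    apply: filterS => t ute; rewrite /g -rmorphB /= expr0n addr0 sqrtr_sqr.
    rewrite (_ : 1 - u x - (1 - u t) = u t - u x)%R; first by rewrite distrC.
    by rewrite opprB [LHS]addrC addrA subrK.
  exists U => // x nUx; rewrite normg.
  have -> : u x = 1%R by apply: u1; exists x => //= /interior_subset.
  by rewrite subrr.
exists (MkC0 gC0) => /=.
  have up0 : u p = 0%R by apply: up; exists p.
  by rewrite /g up0 subr0.
apply: C0_sup_le => // x; rewrite normg gerBl.
by have /andP[] : (u x \in `[0, 1])%R by apply: u01; exists x.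
Qed.

(** The product [theta (x i) (y i) z] is a multiple of [x i], so one compact set
    depending only on the finitely many [x i] serves for every argument [z]. *)
Lemma theta_span_vanish (R : realType) (K : topologicalType)
  (K_countable : forall F : nat -> set K, (forall n, compact (F n)) ->
     exists2 K' : set K, compact K' & \bigcup_n F n `<=` K')
  (S : self_module (C0 R K) -> self_module (C0 R K)) :
  theta_span S ->
  exists2 L : set K, compact L &
    forall p, ~ L p -> forall z, (S z : C0 R K) p = 0%R.
Proof.
move=> [n [c [x [y ->]]]].
have [L HL] := choice (fun i => let: ex_intro2 L cL xL :=
  C0_compact_cozero _ _ K_countable (x i) in ex_intro _ L (conj cL xL)).
exists (\big[setU/set0]_(i < n) L i).
  by apply: bigsetU_compact => i _; exact: (HL i).1.
move=> p nLp z; elim/big_ind : _ => [//|f g fp gp|i _].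
  have -> : (f + g)%R p = ((f : C0 R K) p + (g : C0 R K) p)%R by [].
  by rewrite fp gp addr0.
have -> : (c i *: theta (x i) (y i) z)%R p =
    (c i * ((x i : C0 R K) p * (hinner (y i) z : C0 R K) p))%R by [].
rewrite (HL i).2 ?mul0r ?mulr0 //.
by move=> Lip; apply: nLp; rewrite (bigD1 i) //=; left.
Qed.

Theorem mainTheorem2 (R : realType) (K : topologicalType)
  (K_lc : locally_compact [set: K])
  (K_hausdorff : hausdorff_space K)
  (K_not_sigma : ~ sigma_compact K)
  (K_countable : forall F : nat -> set K, (forall n, compact (F n)) ->
     exists2 K' : set K, compact K' & \bigcup_n F n `<=` K') :
  ~ A_compact (hop_id (self_module (C0 R K))).
Proof.
move=> /(_ 1%R ltr01)[S /theta_span_vanish[//|L cL SL]].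
apply/negP; rewrite -leNgt.
have [p nLp] : exists p, ~ L p.
  apply/not_existsP => LT; apply: K_not_sigma; exists (fun=> L); split=> //.
  by apply/seteqP; split=> // p _; exists 0%N => //; apply: contrapT; exact: LT.
have [f fp f1] := @C0_bump R K K_lc K_hausdorff p.
pose h : C0 R K := (f - (S f : C0 R K))%R.
have hp : h p = 1%R.
  have -> : h p = (f p - (S f : C0 R K) p)%R by [].
  by rewrite fp SL // subr0.
apply: (@le_trans _ _ (C0_sup h)%:E).
  rewrite lee_fin; apply: le_trans (C0_sup_ub h p).
  by rewrite hp normc1.
apply: ereal_sup_ubound; exists (f : self_module (C0 R K)) => //=.
by rewrite [X in (X <= _)%R]C0_normE lecR.
Qed.
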